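(* Let $J:\mathcal{X}\to[0,\infty]$ be a convex one-homogeneous functional on the real Banach space $\mathcal{X}$, let $u,v\in\mathcal{X}\setminus\{0\}$ with $J(u)<\infty$ and $J(v)<\infty$, and let $p(v)\in\partial J(v)$. Then the Bregman distance $D_J^{p(v)}(u,v)=J(u)-J(v)-\langle p(v),u-v\rangle$ satisfies $$D_J^{p(v)}(u,v)=J(u)\bigl(1-\cos(\mathrm{angle}(u,v))\bigr),$$ where $$\mathrm{angle}(u,v):=\cos^{-1}\left(\frac{[u,v]_J^{p(v)}}{J(u)J(v)}\right),\qquad [u,v]_J^{p(v)}:=\langle u,p(v)\rangle J(v).$$
   Context: $\mathcal{X}$ is a real Banach space (of functions) with dual $\mathcal{X}^*$; $\langle\cdot,\cdot\rangle$ denotes the $L^2$ inner product, used as the pairing between $\mathcal{X}$ and $\mathcal{X}^*$. $J:\mathcal{X}\to[0,\infty]$ is proper, convex and lower semi-continuous. One-homogeneous means $J(\alpha u)=|\alpha|J(u)$ for all $\alpha\in\mathbb{R}$, $u\in\mathcal{X}$. It is assumed throughout that $J(u)>0$ for $u\in\mathcal{X}\setminus\{0\}$. The subdifferential is $\partial J(u)=\{p\in\mathcal{X}^* : J(v)-J(u)\ge\langle p,v-u\rangle\ \forall v\in\mathcal{X}\}$. *)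

(* Defs.v *)
From HB Require Import structures.
From mathcomp Require Import all_boot all_order all_algebra.
From mathcomp Require Import all_classical all_reals all_analysis.

Set Implicit Arguments.
Unset Strict Implicit.
Unset Printing Implicit Defensive.

Import Order.TTheory GRing.Theory Num.Theory.
Import numFieldNormedType.Exports.

Local Open Scope classical_set_scope.
Local Open Scope ring_scope.
Local Open Scope ereal_scope.

(* The topological dual; the pairing of p : dual X with u : X is the
   evaluation p u, through the coercions to {linear X -> R^o} and to
   functions. *)
Record dual (R : realType) (X : normedModType R) : Type := Dual {
  dual_linear :> {linear X -> R^o};
  dual_continuous : continuous dual_linear
}.

Section functionals.
Context {R : realType} {X : normedModType R}.
Implicit Types (J : X -> \bar R) (u v w : X) (p : dual X).

(* Intended for J with values in [0, +oo], where the right-hand side involves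
   no +oo - oo; note that 0 * +oo = 0 in \bar R. *)
Definition convex_ereal_function J : Prop :=
  forall u v (t : R), (0 <= t <= 1)%R ->
    J (t *: u + (1 - t) *: v)%R <= t%:E * J u + (1 - t)%:E * J v.

Definition proper_functional J : Prop :=
  (forall u, J u != -oo) /\ (exists u, J u < +oo).

Definition one_homogeneous J : Prop :=
  forall (a : R) u, J (a *: u)%R = `|a|%:E * J u.

(* Since x - +oo = -oo in \bar R for every x, including x = +oo, the
   subdifferential is empty at points where J is +oo. *)
Definition subdifferential J u : set (dual X) :=
  [set p : dual X | forall v, (p (v - u)%R)%:E <= J v - J u].

Definition Bregman_distance J p u v : \bar R :=
  J u - J v - (p (u - v)%R)%:E.

(* [u, v]_J^p *)
Definition bracket J p u v : \bar R := (p u)%:E * J v.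

Definition angle J p u v : R :=
  acos (fine (bracket J p u v / (J u * J v))).

End functionals.

(* Main.v *)
Require Import Defs.
From HB Require Import structures.
From mathcomp Require Import all_boot all_order all_algebra.
From mathcomp Require Import all_classical all_reals all_analysis.
From mathcomp Require Import lra.

Import Order.TTheory GRing.Theory Num.Theory.
Import numFieldNormedType.Exports.

Local Open Scope classical_set_scope.
Local Open Scope ring_scope.
Local Open Scope ereal_scope.

(** A subgradient [p] of a one-homogeneous [J] at a point [v] with [J v] finite
    satisfies [p v = J v] (Euler's identity, [subgradient_euler]) and [p <= J]
    everywhere, hence [|p u| <= J u] by evenness of [J]
    ([subgradient_abs_le]).  The first fact collapses the Bregman distance to
    [J u - p u].  The second says that [p u / J u], the argument of the arc
    cosine after cancelling [J v], lies in [-1, 1], so that the cosine of the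
    angle is exactly [p u / J u] and [J u (1 - cos angle) = J u - p u]. *)

Section one_homogeneous_subgradients.
Context {R : realType} {X : normedModType R}.
Variables (J : X -> \bar R) (v : X) (p : dual X).
Hypotheses (J_hom : one_homogeneous J) (Jv_fin : J v \is a fin_num).
Hypothesis p_sub : subdifferential J v p.

(** Along the ray through [v], the subgradient inequality at [0] gives
    [J v <= p v] and at [2 v] gives [p v <= J v]. *)
Lemma subgradient_euler : J v = (p v)%:E.
Proof.
have := p_sub (0 *: v)%R; have := p_sub (2 *: v)%R.
rewrite !J_hom !linearB !linearZ -(fineK Jv_fin) /= normr0 normr_nat.
rewrite -!EFinM -!EFinB !lee_fin /GRing.scale /= => le2 le0.
by congr EFin; lra.
Qed.

Lemma subgradient_le (w : X) : (p w)%:E <= J w.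
Proof.
have := p_sub w; rewrite [J v]subgradient_euler linearB EFinD EFinN.
by rewrite leeD2rE.
Qed.

Lemma subgradient_abs_le (w : X) : `|p w|%:E <= J w.
Proof.
have JN : J (- w)%R = J w by rewrite -scaleN1r J_hom normrN1 mul1e.
have [_|_] := ger0P (p w); first exact: subgradient_le.
by rewrite -JN -linearN; exact: subgradient_le.
Qed.

Lemma Bregman_distance_subgradient (u : X) :
  Bregman_distance J p u v = J u - (p u)%:E.
Proof.
rewrite /Bregman_distance subgradient_euler linearB -addeA; congr (_ + _).
by rewrite -EFinN -EFinB -EFinN; congr EFin; lra.
Qed.

Lemma cos_angle_subgradient (u : X) :
  0 < J u < +oo -> 0 < J v -> cos (angle J p u v) = (p u / fine (J u))%R.
Proof.
move=> /andP[Ju_gt0 Ju_fin] Jv_gt0.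
have Ju_num : J u \is a fin_num by rewrite gt0_fin_numE.
have pv_gt0 : (0 < p v)%R by rewrite -lte_fin -subgradient_euler.
have := subgradient_abs_le u; rewrite /angle /bracket subgradient_euler.
move: Ju_gt0; rewrite -(fineK Ju_num) lte_fin lee_fin /=.
move: (fine (J u)) => a a_gt0 pu_le.
rewrite -!EFinM inver mulf_eq0 !gt_eqF //= -mulf_div divff ?gt_eqF // mulr1.
by rewrite acosK // in_itv /= -ler_norml normrM normfV (gtr0_norm a_gt0)
  ler_pdivrMr // mul1r.
Qed.

End one_homogeneous_subgradients.

Theorem mainTheorem3 (R : realType) (X : completeNormedModType R)
    (J : X -> \bar R)
    (J_ge0 : forall w : X, 0 <= J w)
    (J_proper : proper_functional J)
    (J_convex : convex_ereal_function J)
    (J_lsc : lower_semicontinuous J)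
    (J_hom : one_homogeneous J)
    (J_gt0 : forall w : X, w <> 0%R -> 0 < J w)
    (u v : X) (u_neq0 : u <> 0%R) (v_neq0 : v <> 0%R)
    (Ju_fin : J u < +oo) (Jv_fin : J v < +oo)
    (p : dual X) (p_sub : subdifferential J v p) :
  Bregman_distance J p u v = J u * (1 - cos (angle J p u v))%:E.
Proof.
have Ju_gt0 := J_gt0 _ u_neq0; have Jv_gt0 := J_gt0 _ v_neq0.
have Ju_num : J u \is a fin_num by rewrite gt0_fin_numE.
have Jv_num : J v \is a fin_num by rewrite gt0_fin_numE.
rewrite (Bregman_distance_subgradient _ _ _ J_hom Jv_num p_sub).
rewrite (cos_angle_subgradient _ _ _ J_hom Jv_num p_sub) ?Ju_gt0 //.
rewrite -(fineK Ju_num) -EFinB -EFinM; congr EFin.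
by rewrite mulrBr mulr1 mulrCA divff ?mulr1 // gt_eqF // fine_gt0 // Ju_gt0.
Qed.
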